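(* Let $p$ be the peak value of the Collatz sequence starting at some positive integer $n$ (assumed to have a maximum), let $u$ be the odd number immediately before $p$ in this sequence, and let $v$ be the odd number immediately after $p$. Suppose $u=4^t k+\frac{4^t-1}{3}$ with a positive integer $t$ and $k=2l$ for a positive integer $l$. Then $4^t\mid p$ and $v=6l+1$.
   Context: The Collatz map $T$ on the positive integers is $T(m)=m/2$ if $m$ is even and $T(m)=3m+1$ if $m$ is odd; $T^i$ denotes its $i$-fold iterate. The Collatz sequence starting at $n$ is the infinite sequence $n, T(n), T^2(n),\dots$. Its peak value is the maximum of all its terms. That $u$ is the odd number immediately before $p$ means that $u$ is odd and, for some $i\ge 0$, $T^i(n)=u$ and $T^{i+1}(n)=T(u)=p$. The odd number $v$ immediately after $p$ is the first odd term of the sequence $T(p),T^2(p),\dots$ (equivalently, the odd part of the even number $p$). *)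

(* Defs.v *)
From mathcomp Require Import all_boot.

Set Implicit Arguments.
Unset Strict Implicit.
Unset Printing Implicit Defensive.

(* The map is meant on positive integers; the junk value at 0 is 0, and no
   positive integer is ever sent to 0. *)
Definition collatz (m : nat) : nat := if odd m then 3 * m + 1 else m %/ 2.

Definition is_peak (n p : nat) : Prop :=
  (exists i, iter i collatz n = p) /\ (forall i, iter i collatz n <= p).

Definition odd_before (n p u : nat) : Prop :=
  odd u /\ exists i, iter i collatz n = u /\ iter i.+1 collatz n = p.

(* First odd term of T(p), T^2(p), ...; the search starts at index 1, so that
   p itself is not a candidate. *)
Definition odd_after (p v : nat) : Prop :=
  odd v /\ exists j, [/\ 0 < j, iter j collatz p = v &
                         forall i, 0 < i < j -> ~~ odd (iter i collatz p)].

(* Main.v *)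
Require Import Defs.
From mathcomp Require Import all_boot.

(** Writing 3u + 1 = 3 * 4^t k + (4^t - 1) + 1 = 4^t (3k + 1) shows that the
    successor of [u] is 4^t (6l + 1) once k = 2l ([collatz_inflated]).  The
    cofactor 6l + 1 is odd, so it is the odd part of [p], and repeated halving
    cannot meet an odd number before reaching the odd part
    ([odd_after_odd_part]). *)

Lemma iter_collatz_pow2 e q j :
  j <= e -> iter j collatz (2 ^ e * q) = 2 ^ (e - j) * q.
Proof.
elim: j => [|j IHj] lt_je; first by rewrite subn0.
rewrite iterS IHj; last exact: ltnW.
rewrite -(subnSK lt_je) expnS -mulnA /collatz oddM /=.
by rewrite mulKn.
Qed.

(** The orbit of 2^e q decreases the exponent of 2 by one at each step, so an
    odd term cannot occur before step [e], while the term at step [e] is [q]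
    itself and stops the search.  The case e = 0 is excluded because the search
    starts after the initial term. *)
Lemma odd_after_odd_part e q v :
  0 < e -> odd q -> odd_after (2 ^ e * q) v -> v = q.
Proof.
move=> e_gt0 odd_q [odd_v [j [_ def_v first_j]]].
have at_e : iter e collatz (2 ^ e * q) = q.
  by rewrite iter_collatz_pow2 // subnn mul1n.
case: (ltngtP j e) => [lt_je | lt_ej | eq_je].
- move: odd_v; rewrite -def_v iter_collatz_pow2 ?(ltnW lt_je) //.
  by rewrite oddM oddX subn_eq0 leqNgt lt_je.
- have := first_j e; rewrite e_gt0 lt_ej at_e odd_q => /(_ isT).
  by [].
- by rewrite -def_v eq_je.
Qed.

(** The number (4^t - 1) / 3 is 1 + 4 + ... + 4^(t-1), so the division is exact
    and tripling then adding 1 turns it into 4^t. *)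
Lemma collatz_inflated t k :
  3 * (4 ^ t * k + (4 ^ t - 1) %/ 3) + 1 = 4 ^ t * (3 * k + 1).
Proof.
have dvd3 : 3 %| 4 ^ t - 1 by rewrite subn1 predn_exp dvdn_mulr.
rewrite mulnDr [3 * (_ %/ 3)]mulnC divnK // -addnA subnK ?expn_gt0 //.
by rewrite mulnDr muln1 mulnCA.
Qed.

Theorem theorem2p25 (n p u v t k l : nat) (n_gt0 : 0 < n)
    (peak_p : is_peak n p) (before_u : odd_before n p u)
    (after_v : odd_after p v)
    (t_gt0 : 0 < t) (l_gt0 : 0 < l) (k_def : k = 2 * l)
    (u_def : u = 4 ^ t * k + (4 ^ t - 1) %/ 3) :
  4 ^ t %| p /\ v = 6 * l + 1.
Proof.
have def_p : p = 4 ^ t * (6 * l + 1).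
  case: before_u => odd_u [i [at_u <-]].
  by rewrite iterS at_u /collatz odd_u u_def collatz_inflated k_def mulnA.
split; first by rewrite def_p dvdn_mulr.
apply: (@odd_after_odd_part (2 * t)); first by rewrite muln_gt0.
  by rewrite oddD oddM.
by rewrite expnM -[2 ^ 2]/4 -def_p.
Qed.
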